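(* Let $\mathcal H$ be an infinite dimensional separable complex Hilbert space and let $T$ be a diskcyclic bounded linear operator on $\mathcal H$ such that $\sigma_p(T^* )=\emptyset$. Then there is a dense linear subspace $\mathcal A$ of $\mathcal H$ that is invariant under $T$ and all of whose non-zero elements are diskcyclic vectors for $T$.
   Context: A vector $x\in\mathcal H$ is diskcyclic for $T$ if $\{\alpha T^n x : n\ge 0,\ \alpha\in\mathbb C,\ |\alpha|\le 1\}$ is dense in $\mathcal H$; $T$ is diskcyclic if it has a diskcyclic vector. $\sigma_p(T^* )$ is the point spectrum (set of eigenvalues) of the adjoint $T^*$. The subspace $\mathcal A$ is invariant under $T$ if $T\mathcal A\subseteq\mathcal A$. *)

(* Defs.v *)
From HB Require Import structures.
From mathcomp Require Import all_boot all_order all_algebra.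
From mathcomp Require Import complex.
From mathcomp Require Import all_classical all_reals all_analysis.

Set Implicit Arguments.
Unset Strict Implicit.
Unset Printing Implicit Defensive.

Import Order.TTheory GRing.Theory Num.Theory.
Import numFieldNormedType.Exports.

Local Open Scope classical_set_scope.
Local Open Scope ring_scope.

Definition separable_space (V : topologicalType) : Prop :=
  exists2 D : set V, countable D & dense D.

Definition finite_dimensional (K : fieldType) (V : lmodType K) : Prop :=
  exists (n : nat) (e : 'I_n -> V),
    forall x : V, exists c : 'I_n -> K, x = \sum_(i < n) c i *: e i.

Definition bounded_operator (K : numFieldType) (V W : normedModType K)
    (T : V -> W) : Prop :=
  exists M : K, forall x : V, `|T x| <= M * `|x|.

(* A Hilbert space is a complete normed space whose norm comes from an inner
   product; mathcomp's dot forms are linear in the first argument and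
   conjugate-linear in the second. *)
Definition induces_norm (R : realType) (H : normedModType R[i])
    (dot : {dot H for Num.conj}) : Prop :=
  forall x : H, `|x| ^+ 2 = dot x x.

(* On a Hilbert space the vector z below exists for bounded T (Riesz) and is
   unique, so the default value 0 of xget is not used. *)
Definition adjoint (R : realType) (H : normedModType R[i])
    (dot : {dot H for Num.conj}) (T : H -> H) : H -> H :=
  fun y => xget 0 [set z | forall x, dot (T x) y = dot x z].

Definition point_spectrum (K : fieldType) (V : lmodType K) (S : V -> V) :
    set K :=
  [set l | exists2 v : V, v != 0 & S v = l *: v].

Definition disk_orbit (K : numFieldType) (V : normedModType K)
    (T : V -> V) (x : V) : set V :=
  [set y | exists (n : nat) (a : K), `|a| <= 1 /\ y = a *: iter n T x].

Definition diskcyclic_vector (K : numFieldType) (V : normedModType K)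
    (T : V -> V) (x : V) : Prop :=
  dense (disk_orbit T x).

Definition diskcyclic (K : numFieldType) (V : normedModType K)
    (T : V -> V) : Prop :=
  exists x : V, diskcyclic_vector T x.

(* Main.v *)
Require Import Defs.
From HB Require Import structures.
From mathcomp Require Import all_boot all_order all_algebra.
From mathcomp Require Import complex ring.
From mathcomp Require Import all_classical all_reals all_analysis.
Set Implicit Arguments.
Unset Strict Implicit.
Unset Printing Implicit Defensive.

Import Order.TTheory GRing.Theory Num.Theory.
Import numFieldNormedType.Exports.
Local Open Scope classical_set_scope.
Local Open Scope ring_scope.

(** For a diskcyclic vector x, take A to be the set of all p(T) x with p a
    polynomial.  Since C is algebraically closed, p(T) is for p != 0 a nonzero
    multiple of a product of operators T - a.  Each T - a has dense range,
    since a nonzero vector orthogonal to that range would be an eigenvector of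
    the adjoint for the conjugate of a.  Hence p(T), which commutes with T,
    maps the dense disk orbit of x onto a dense set, the disk orbit of
    p(T) x. *)

(** * Dense sets and their continuous images *)

Lemma dense_sub (X : topologicalType) (A B : set X) :
  A `<=` B -> dense A -> dense B.
Proof. by move=> AB dA O O0 Oo; have [x [Ox /AB Bx]] := dA O O0 Oo; exists x. Qed.

Lemma dense_image (X Y : topologicalType) (f : X -> Y) (S : set X) :
  continuous f -> dense (range f) -> dense S -> dense (f @` S).
Proof.
move=> /continuousP fc fd Sd O O0 Oo.
have [y [Oy [x _ xE]]] := fd O O0 Oo.
have [|z [Oz Sz]] := Sd _ _ (fc O Oo); first by exists x; rewrite /= xE.
by exists (f z); split => //; exists z.
Qed.

Lemma not_dense_dist (K : numFieldType) (V : normedModType K) (S : set V) :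
  ~ dense S -> exists x : V, exists2 e : K, 0 < e & forall s, S s -> e <= `|x - s|.
Proof.
move=> /denseNE[A [[x [Ao Ax]] AS]].
have /nbhs_ballP[e /= e0 xe] : nbhs x A by exact: open_nbhs_nbhs.
exists x; exists e => // s Ss; rewrite (real_leNgt (gtr0_real e0) (normr_real _)).
apply/negP => xs.
have : (A `&` S) s by split => //; apply: xe; rewrite -ball_normE.
by rewrite AS.
Qed.

(** * Polynomials in a linear operator *)

Section polyop.
Context (K : comNzRingType) (V : lmodType K) (T : {linear V -> V}).

Definition polyop (p : {poly K}) (y : V) : V :=
  \sum_(i < size p) p`_i *: iter i T y.

Implicit Types (p q : {poly K}) (y z : V).

(** Brings polynomials of different sizes to a common range of summation, so that their sums can be
    compared term by term. *)
Lemma polyop_widen n p y : (size p <= n)%N ->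
  polyop p y = \sum_(i < n) p`_i *: iter i T y.
Proof.
move=> pn; rewrite /polyop -!(big_mkord xpredT (fun i => p`_i *: iter i T y)).
rewrite [RHS](big_cat_nat (n := size p))//= [X in _ + X]big1_seq ?addr0// => i.
by rewrite mem_index_iota => /and3P[_ pi _]; rewrite nth_default// scale0r.
Qed.

Lemma polyopDl a p q y : polyop (a *: p + q) y = a *: polyop p y + polyop q y.
Proof.
pose n := maxn (size (a *: p + q)) (maxn (size p) (size q)).
rewrite !(@polyop_widen n) ?leq_max ?leqnn ?orbT//.
rewrite scaler_sumr -big_split; apply: eq_bigr => i _ /=.
by rewrite coefD coefZ scalerDl scalerA.
Qed.

Lemma iter_linear n a y z : iter n T (a *: y + z) = a *: iter n T y + iter n T z.
Proof. by elim: n => //= n ->; rewrite linearP. Qed.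

Lemma polyopDr p a y z : polyop p (a *: y + z) = a *: polyop p y + polyop p z.
Proof.
rewrite /polyop scaler_sumr -big_split; apply: eq_bigr => i _ /=.
by rewrite iter_linear scalerDr !scalerA mulrC.
Qed.

Lemma polyop0l y : polyop 0 y = 0.
Proof. by rewrite /polyop size_poly0 big_ord0. Qed.

Lemma polyopr0 p : polyop p 0 = 0.
Proof. by have := polyopDr p (-1) 0 0; rewrite scaler0 addr0 scaleN1r addNr. Qed.

Lemma polyopZl a p y : polyop (a *: p) y = a *: polyop p y.
Proof. by have := polyopDl a p 0 y; rewrite polyop0l !addr0. Qed.

Lemma polyopZr p a y : polyop p (a *: y) = a *: polyop p y.
Proof. by have := polyopDr p a y 0; rewrite polyopr0 !addr0. Qed.

Lemma polyop1 y : polyop 1 y = y.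
Proof. by rewrite /polyop size_poly1 big_ord1 coef1 scale1r. Qed.

Lemma polyop_commute p y : polyop p (T y) = T (polyop p y).
Proof.
rewrite /polyop linear_sum; apply: eq_bigr => i _.
by rewrite -iterSr iterS linearZ.
Qed.

Lemma polyop_commute_iter p n y : polyop p (iter n T y) = iter n T (polyop p y).
Proof. by elim: n => //= n <-; rewrite polyop_commute. Qed.

Lemma polyopMX p y : polyop (p * 'X) y = polyop p (T y).
Proof.
(* The size of [p * 'X] is [(size p).+1] only for [p != 0], so the sum is first widened to that
   range; its term of index 0 then vanishes. *)
rewrite (@polyop_widen (size p).+1); last first.
  by rewrite (leq_trans (size_polyMleq _ _))// size_polyX addn2.
rewrite big_ord_recl coefMX scale0r add0r; apply: eq_bigr => i _.
by rewrite coefMX /= -iterSr.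
Qed.

Lemma polyopXn n y : polyop 'X^n y = iter n T y.
Proof. by elim: n y => [|n IH] y; rewrite ?polyop1// exprSr polyopMX IH -iterSr. Qed.

Lemma polyopMXsubC p a y : polyop (p * ('X - a%:P)) y = polyop p (T y - a *: y).
Proof.
have -> : p * ('X - a%:P) = (- a) *: p + p * 'X.
  by rewrite mulrBr addrC [p * a%:P]mulrC mul_polyC scaleNr.
by rewrite polyopDl polyopMX -scaleNr [T y + _]addrC polyopDr.
Qed.

End polyop.

(** Induction on the list of roots of [p]. The dense set is kept arbitrary because each factor T - a
    replaces it by its image, which is again dense. *)
Lemma dense_polyop_image (K : numClosedFieldType) (V : normedModType K)
    (T : {linear V -> V}) (p : {poly K}) (S : set V) :
  (forall a, continuous (fun x : V => T x - a *: x)) ->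
  (forall a, dense (range (fun x : V => T x - a *: x))) ->
  p != 0 -> dense S -> dense (polyop T p @` S).
Proof.
move=> Tc Td p0 Sd.
have [rs pE] := closed_field_poly_normal p.
have c0 : lead_coef p != 0 by rewrite lead_coef_eq0.
move: (lead_coef p) c0 pE => c c0 {p0}->.
(* The leading coefficient is absorbed into the set: scaling by [c != 0] is continuous and onto, so
   it preserves density. *)
have [U Ud UE] : exists2 U : set V, dense U &
    polyop T (c *: \prod_(z <- rs) ('X - z%:P)) @` S =
    polyop T (\prod_(z <- rs) ('X - z%:P)) @` U.
  exists ( *:%R c @` S).
    apply: dense_image => //; first exact: scaler_continuous.
    move=> O [x Ox] _; exists x; split => //.
    by exists (c^-1 *: x); rewrite ?scalerA ?divff ?scale1r.
  rewrite image_comp; apply: eq_imagel => x _.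
  by rewrite /= polyopZl polyopZr.
rewrite {}UE; elim: rs U Ud => [|a rs IH] U Ud.
  rewrite big_nil; apply: dense_sub Ud => x Ux; exists x => //.
  exact: polyop1.
rewrite big_cons mulrC.
have -> : polyop T (\prod_(z <- rs) ('X - z%:P) * ('X - a%:P)) @` U =
    polyop T (\prod_(z <- rs) ('X - z%:P)) @` ((fun x => T x - a *: x) @` U).
  by rewrite image_comp; apply: eq_imagel => x _ /=; rewrite polyopMXsubC.
by apply: IH; exact: dense_image.
Qed.

Lemma bounded_operator_continuous (K : numFieldType) (V W : normedModType K)
    (T : {linear V -> W}) : bounded_operator T -> continuous T.
Proof.
move=> [M MT]; apply/linear_bounded_continuous/linear_boundedP.
near=> r => x.
(* [M] is not assumed to be real, but [M * |x|] bounds a norm, so it is non-negative and equals its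
   own modulus [|M| * |x|]. *)
apply: (@le_trans _ _ (`|M| * `|x|)).
  by rewrite -[X in _ * X]normr_id -normrM ger0_norm// (le_trans _ (MT x)).
apply: ler_wpM2r => //; near: r.
Unshelve. all: by end_near. Qed.

(** Norms take values in [R[i]], whose order is only partial. Non-negative elements are real, so the
    infimum is formed in [R] and embedded back. *)
Lemma complex_inf (R : realType) (A : set R[i]) :
  A !=set0 -> (forall a, A a -> 0 <= a) ->
  exists d : R[i], (forall a, A a -> d <= a) /\
    forall e, 0 < e -> exists2 a, A a & a < d + e.
Proof.
move=> [a0 Aa0] A0.
pose E := [set r : R | A (r%:C)%C].
have AE a : A a -> E (complex.Re a) /\ a = (complex.Re a)%:C%C.
  by move=> Aa; have aE := RRe_real (ger0_real (A0 _ Aa)); rewrite /E /= aE.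
have Elb : lbound E 0 by move=> r /A0; rewrite ler0c.
have Einf : has_inf E by split; [exists (complex.Re a0); apply AE | exists 0].
exists (inf E)%:C%C; split.
  move=> a /AE[Ea ->]; rewrite lecR; apply: ge_inf Ea; exact: Einf.2.
move=> e e0.
have eE := RRe_real (gtr0_real e0).
have e1 : 0 < complex.Re e by rewrite -ltcR eE.
have [r Er rlt] := inf_adherent e1 Einf.
by exists r%:C%C => //; rewrite -eE -rmorphD ltcR.
Qed.

(** * Orthogonality and nearest points in a Hilbert space *)

Section orthogonality.
Context (R : realType) (H : completeNormedModType R[i]).
Context (dot : {dot H for Num.conj}) (dotE : induces_norm dot).

Lemma dotC u v : dot u v = (dot v u)^*.
Proof. by rewrite hermC expr0 mul1r. Qed.

(* Expand the hypothesis at t = dot y w / `|w| ^+ 2, which minimizes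
   `|y - t *: w|. *)
Lemma almost_minimal_dot (d : R[i]) (y w : H) :
  (forall t, d <= `|y - t *: w| ^+ 2) ->
  `|dot w y| ^+ 2 <= (`|y| ^+ 2 - d) * `|w| ^+ 2.
Proof.
move=> yw; have [->|w0] := eqVneq w 0.
  by rewrite linear0l !normr0 expr0n mulr0.
have W0 : 0 < `|w| ^+ 2 by rewrite exprn_gt0// normr_gt0.
rewrite -ler_pdivrMr//.
have := yw (dot y w / `|w| ^+ 2).
set t := _ / _; pose a := `|dot w y| ^+ 2 / `|w| ^+ 2.
have aC : a^* = a by apply/CrealP; rewrite realM ?realV ?realX ?normr_real.
have tw : dot (t *: w) y = a.
  by rewrite linearZl_LR/= /a normCK -dotC mulrC mulrA.
have ttw : `|t| ^+ 2 * `|w| ^+ 2 = a.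
  rewrite /t /a normrM normfV normrX normr_id exprMn.
  rewrite [dot y w]dotC norm_conjC -mulrA.
  by rewrite [_^-1 ^+ 2]expr2 -[_^-1 * _ * _]mulrA mulVf ?gt_eqF// mulr1.
rewrite dotE dnormB [dot y (t *: w)]dotC tw !aC -!dotE normrZ exprMn ttw -/a.
by rewrite opprD addrA addrK !lerBrDr addrC.
Qed.

Lemma CauchySchwarz_norm (u v : H) : `|dot u v| <= `|u| * `|v|.
Proof.
rewrite -(@ler_pXn2r _ 2)// ?nnegrE ?mulr_ge0// exprMn mulrC.
have := @almost_minimal_dot 0 v u; rewrite subr0; apply.
by move=> t; rewrite exprn_ge0.
Qed.

Lemma parallelogram (u v : H) :
  `|u + v| ^+ 2 + `|u - v| ^+ 2 = (`|u| ^+ 2 + `|v| ^+ 2) *+ 2.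
Proof. by rewrite !dotE dnormD dnormB addrACA subrr addr0 mulr2n. Qed.

Section nearest.
Context (W : set H) (W0 : W 0) (WP : forall a u v, W u -> W v -> W (a *: u + v)).
Context (x : H) (d : R[i]).
Context (dW : forall w, W w -> d <= `|x - w| ^+ 2).
Context (Wd : forall e, 0 < e -> exists2 w, W w & `|x - w| ^+ 2 < d + e).

(** The parallelogram law for [x - v] and [x - u]: their sum is twice [x - m] with m the midpoint of
    [u] and [v]. Since m is in [W], the squared norm of that sum is at least 4d, while the
    right-hand side is below 4(d + e). *)
Lemma near_minimizers_close e u v : W u -> W v ->
  `|x - u| ^+ 2 < d + e -> `|x - v| ^+ 2 < d + e -> `|u - v| ^+ 2 < e *+ 4.
Proof.
move=> Wu Wv ux vx.
have Wm : W (2^-1 *: u + 2^-1 *: v).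
  by apply: WP => //; rewrite -[_ *: v]addr0; exact: WP.
have := parallelogram (x - v) (x - u).
have -> : x - v - (x - u) = u - v by rewrite opprB addrC addrA subrK.
have -> : x - v + (x - u) = 2 *: (x - (2^-1 *: u + 2^-1 *: v)).
  rewrite scalerBr scalerDr !scalerA divff ?pnatr_eq0// !scale1r scaler_nat mulr2n.
  by rewrite [u + v]addrC opprD addrACA.
rewrite normrZ exprMn => E.
have := dW Wm; set m := `|x - (2^-1 *: u + _)| ^+ 2 in E * => dm.
have -> : `|u - v| ^+ 2 = (`|x - v| ^+ 2 + `|x - u| ^+ 2) *+ 2 - `|2| ^+ 2 * m.
  by rewrite -E addrAC subrr add0r.
rewrite ltrBlDr.
apply: (@lt_le_trans _ _ ((d + e) *+ 4)).
  by rewrite -[4%N]/(2 * 2)%N mulrnA ltr_pMn2r// mulr2n ltrD.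
rewrite mulrnDl addrC lerD2l.
by rewrite ger0_norm// -natrX mulr_natl ler_pMn2r.
Qed.

(** The near-minimizers form a Cauchy filter base, and completeness gives its limit [z]. As [W] need
    not be closed, [z] may lie outside it, hence the approximating points [u] in [W]. *)
Lemma minimizing_limit : exists z : H,
  forall e, 0 < e -> exists u, [/\ W u, `|x - u| ^+ 2 < d + e ^+ 2 & `|u - z| < e].
Proof.
pose M e := [set w | W w /\ `|x - w| ^+ 2 < d + e].
pose F := filter_from [set e : R[i] | 0 < e] M.
have FF : ProperFilter F.
  apply: filter_from_proper; last by move=> e /Wd[w Ww we]; exists w.
  apply: filter_from_filter; first by exists 1; rewrite /= ltr01.
  move=> e e' e0 e'0; have Msub a b : a <= b -> M a `<=` M b.
    by move=> ab w [Ww wa]; split => //; apply: (lt_le_trans wa); rewrite lerD2l.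
  (* Positive elements of [R[i]] are real, hence comparable. *)
  have /orP[ee'|e'e] := real_leVge (gtr0_real e0) (gtr0_real e'0).
  - by exists e => // w Mw; split => //; exact: Msub Mw.
  - by exists e' => // w Mw; split => //; exact: Msub Mw.
have : cauchy F.
  apply: cauchy_exP => e e0.
  (* The excess [e ^+ 2 / 4] cancels the factor 4 of [near_minimizers_close], leaving distance below
     [e]. *)
  have e40 : 0 < e ^+ 2 / 4 by rewrite divr_gt0// exprn_gt0.
  have [w Ww we] := Wd e40.
  exists w, (e ^+ 2 / 4) => // v [Wv ve].
  rewrite -ball_normE /= -(@ltr_pXn2r _ 2)// ?nnegrE ?(ltW e0)//.
  rewrite (lt_le_trans (near_minimizers_close Ww Wv we ve))//.
  by rewrite -[_ *+ 4]mulr_natr divfK// pnatr_eq0.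
move=> /cauchy_cvgP/cvg_ex[z Fz]; exists z => e e0.
have ze : F (ball z e) by apply: Fz; exact: nbhsx_ballx.
have Me : F (M (e ^+ 2)) by exists (e ^+ 2) => //=; rewrite exprn_gt0.
have [u [zu [Wu ue]]] := filter_ex (filterI ze Me).
by exists u; split => //; rewrite distrC; move: zu; rewrite -ball_normE.
Qed.

End nearest.

(** Take [x] at positive distance from [W] and [z] the limit of near-minimizers; then [x - z] is
    orthogonal to [W]. For [u] in [W] near [z], split [x - z] into [x - u], handled by
    [almost_minimal_dot], and [u - z], handled by Cauchy-Schwarz. *)
Lemma orthogonal_of_not_dense (W : set H) :
  W 0 -> (forall a u v, W u -> W v -> W (a *: u + v)) -> ~ dense W ->
  exists2 y, y != 0 & forall w, W w -> dot w y = 0.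
Proof.
move=> W0 WP /not_dense_dist[x [r r0 rW]].
have [||d [dW Wd]] := @complex_inf R [set `|x - w| ^+ 2 | w in W].
- by exists (`|x - 0| ^+ 2); exists 0.
- by move=> _ [w _ <-]; rewrite exprn_ge0.
have [||z zP] := @minimizing_limit W W0 WP x d.
- by move=> w Ww; apply: dW; exists w.
- by move=> e /Wd[_ [w Ww <-] we]; exists w.
exists (x - z).
  apply/eqP => /eqP; rewrite subr_eq0 => /eqP xz.
  have [u [Wu _]] := zP _ r0; rewrite -xz distrC => xu.
  by have := lt_le_trans xu (rW _ Wu); rewrite ltxx.
move=> w Ww; have [->|w0] := eqVneq w 0; first by rewrite linear0l.
apply/eqP; apply: contraT => wy.
have nw : 0 < `|w| by rewrite normr_gt0.
(* With this [e], the two bounds [e * |w|] add up to half of [|dot w (x - z)|], which forces that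
   modulus to be 0. *)
pose e := `|dot w (x - z)| / (`|w| *+ 4).
have e0 : 0 < e by rewrite divr_gt0 ?normr_gt0// pmulrn_lgt0.
have [u [Wu ue uz]] := zP _ e0.
have ux : `|dot w (x - u)| <= e * `|w|.
  rewrite -(@ler_pXn2r _ 2)// ?nnegrE ?mulr_ge0 ?(ltW e0)// exprMn.
  apply: (le_trans (@almost_minimal_dot d (x - u) w _)).
    move=> t; rewrite -addrA -opprD [u + _]addrC; apply: dW.
    by exists (t *: w + u) => //; exact: WP.
  rewrite ler_wpM2r ?exprn_ge0// lerBlDl; exact: ltW.
have uzw : `|dot w (u - z)| <= e * `|w|.
  by rewrite (le_trans (CauchySchwarz_norm _ _))// mulrC ler_wpM2r// ltW.
have : `|dot w (x - z)| <= e * `|w| *+ 2.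
  rewrite -(subrK u x) -addrA linearDr (le_trans (ler_normD _ _))//.
  by rewrite mulr2n lerD.
have -> : e * `|w| *+ 2 = `|dot w (x - z)| / 2.
  rewrite /e; set n := `|w| in nw *; set c := `| _ |.
  field.
  by rewrite gt_eqF.
by rewrite ler_pdivlMr// mulr_natr mulr2n gerDl normr_le0 (negPf wy).
Qed.

Lemma dense_range_of_empty_adjoint_spectrum (T : {linear H -> H}) (a : R[i]) :
  point_spectrum (adjoint dot T) = set0 ->
  dense (range (fun x : H => T x - a *: x)).
Proof.
move=> Tspec; apply: contrapT => /(orthogonal_of_not_dense _ _)[].
- by exists 0 => //; rewrite linear0 scaler0 subr0.
- move=> b _ _ [u _ <-] [v _ <-]; exists (b *: u + v) => //.
  by rewrite linearP scalerBr scalerDr opprD addrACA !scalerA [b * a]mulrC.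
move=> y y0 yT; suff : point_spectrum (adjoint dot T) a^* by rewrite Tspec.
have Ty x : dot (T x) y = a * dot x y.
  have /eqP : dot (T x - a *: x) y = 0 by apply: yT; exists x.
  by rewrite linearBl subr_eq0 => /eqP ->; rewrite linearZl_LR.
have dotZr x : dot x (a^* *: y) = a * dot x y.
  by rewrite dotC linearZl_LR/= rmorphM/= conjCK -dotC.
(* The vector [a^* *: y] has the property that defines the adjoint at [y]. Any other such [z] agrees
   with it: testing against [w], their difference, gives [dot w w = 0], so [xget] returns
   [a^* *: y]. *)
exists y => //; apply: xget_unique => [x|z zP]; first by rewrite Ty dotZr.
apply/eqP; rewrite -subr_eq0 -(dnorm_eq0 dot).
set w := z - _; rewrite {2}/w linearBr/= dotZr -zP Ty.
by rewrite subrr.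
Qed.

End orthogonality.

(** * The subspace generated by the orbit of a diskcyclic vector *)

Theorem theorem3p2 (R : realType) (H : completeNormedModType R[i])
    (dot : {dot H for Num.conj}) (dotE : induces_norm dot)
    (Hsep : separable_space H) (Hinf : ~ finite_dimensional H)
    (T : {linear H -> H}) (Tbounded : bounded_operator T)
    (Tdisk : diskcyclic T)
    (Tspec : point_spectrum (adjoint dot T) = set0) :
  exists A : set H,
    [/\ submod_closed [in A],
        dense A,
        T @` A `<=` A
      & forall x : H, A x -> x != 0 -> diskcyclic_vector T x].
Proof.
have Tc := bounded_operator_continuous Tbounded.
have [x xT] := Tdisk.
exists (range (fun p => polyop T p x)); split.
- split; first by rewrite inE; exists 0; rewrite ?polyop0l.
  move=> a u v; rewrite !inE => -[p _ <-] [q _ <-].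
  by exists (a *: p + q) => //; exact: polyopDl.
(* The monomials [a *: 'X^n] already yield the whole disk orbit of [x]. *)
- apply: dense_sub xT => _ [n [a [_ ->]]]; exists (a *: 'X^n) => //.
  by rewrite polyopZl polyopXn.
- move=> _ [_ [p _ <-] <-]; exists (p * 'X) => //.
  by rewrite polyopMX polyop_commute.
move=> _ [p _ <-] px0.
have p0 : p != 0 by apply: contraNneq px0 => ->; rewrite polyop0l.
have Tac a : continuous (fun y : H => T y - a *: y).
  by move=> y; apply: cvgB; [exact: Tc|exact: scaler_continuous].
have Tad a : dense (range (fun y : H => T y - a *: y)).
  exact: (dense_range_of_empty_adjoint_spectrum dotE).
apply: dense_sub (dense_polyop_image Tac Tad p0 xT).
move=> _ [_ [n [a [a1 ->]]] <-]; exists n, a; split => //.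
by rewrite polyopZr polyop_commute_iter.
Qed.
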